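(* Let $p$ be a prime, $n=rk$ with $r>1$, and $f(x)=T^n_k(\beta x^{p^i+p^j})$ on $\mathbb{F}_{p^n}$, where $\beta\in\mathbb{F}_{p^n}^*$, $0\le i\le n-1$ and $j=i+kl$ for some $0<l<r$. Assume that $\gamma\in\mathbb{F}_{p^n}^*$ is a $b$-linear translator of $f$, where $b=T^n_k(\beta\gamma^{p^i+p^{i+lk}})$. Then: (i) If $p=2$, the condition $$\beta\gamma^{p^{i+lk}}+\beta^{p^{(r-l)k}}\gamma^{p^{i+(r-l)k}}=0$$ must be satisfied, and either $b=T^n_k(\beta\gamma^{2^i+2^{i+lk}})$ and $i=sk-1$ for some $0<s\le r$, or $b=0$. In particular, (for $p=2$) if $\beta\in\mathbb{F}_{2^k}$ then $\gamma=1$ is a $0$-linear translator of $f$ if $r$ is even, and $\gamma=1$ is a $\beta$-linear translator of $f$ if $r$ is odd, where in the latter case $i=sk-1$ (for some $0<s\le r$). (ii) If $p>2$, necessarily $b=0$. In particular, if $\beta\in\mathbb{F}_{p^k}$ then $n$ is even and $\gamma$ must satisfy $\gamma^{p^{2kl}-1}=-1$ and $T^n_k(\gamma^{1+p^{lk}})=0$.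
   Context: $T^n_k(x)=x+x^{p^k}+\dots+x^{p^{(r-1)k}}$ is the trace $\mathbb{F}_{p^n}\to\mathbb{F}_{p^k}$. For $f:\mathbb{F}_{p^n}\to\mathbb{F}_{p^k}$, $\gamma\in\mathbb{F}_{p^n}^*$ is a $b$-linear translator of $f$ ($b\in\mathbb{F}_{p^k}$) if $f(x+u\gamma)-f(x)=ub$ for all $x\in\mathbb{F}_{p^n}$ and all $u\in\mathbb{F}_{p^k}$. The ''in particular'' clause of (i) asserts that, in characteristic 2 with $\beta\in\mathbb{F}_{2^k}$, the element $1$ is a translator as described: for $r$ even unconditionally, for $r$ odd when $i=sk-1$. *)

(* Defs.v *)
From mathcomp Require Import all_boot all_order all_algebra.

Set Implicit Arguments.
Unset Strict Implicit.
Unset Printing Implicit Defensive.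

Import GRing.Theory.
Local Open Scope ring_scope.

(* T^n_k(x) = x + x^(p^k) + ... + x^(p^((r-1)k)) with r = n / k; as a map into
   the subfield of order p^k it is only meaningful when k > 0 divides n. *)
Definition fin_trace (F : finFieldType) (p n k : nat) (x : F) : F :=
  \sum_(m < n %/ k) x ^+ (p ^ (m * k)).

(* The function T^n_k (beta x^(p^i + p^j)). *)
Definition quad_trace (F : finFieldType) (p n k i j : nat) (beta x : F) : F :=
  fin_trace p n k (beta * x ^+ (p ^ i + p ^ j)).

(* gamma is a b-linear translator of f : F -> K, for K a subfield of F; the
   codomain of f is expressed by the first conjunct. *)
Definition linear_translator (F : finFieldType) (K : divringClosed F)
    (f : F -> F) (b gamma : F) : Prop :=
  [/\ forall x : F, f x \in K, gamma != 0, b \in K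
    & forall x u : F, u \in K -> f (x + u * gamma) - f x = u * b].

(* Main.v *)
(* Write P = p^i and q = p^k, so that u^q = u on F_q.  Expanding the quadratic
   form and moving Frobenius across the trace gives
     f(x + u gamma) - f(x) = u^P T(C x^P) + u^(2P) f(gamma),
   C = beta gamma^(P q^l) + beta^(q^(r-l)) gamma^(P q^(r-l)).
   Since the trace form is nondegenerate and x |-> x^P is onto, gamma is a
   b-linear translator with b = f(gamma) iff C = 0 and u^(2P) b = u b on F_q.
   For odd p, u = -1 forces b = 0; for p = 2 and b != 0 the map u |-> u^(2^(i+1))
   is the identity on F_(2^k), so k divides i + 1.  For odd p and beta in F_q,
   C = 0 says that the (2kl)-th power of Frobenius maps gamma to - gamma. *)

Require Import Defs.
From mathcomp Require Import all_boot all_order all_algebra all_field ring.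

Import GRing.Theory.
Local Open Scope ring_scope.

(** * Finite subfields as fixed points of power maps *)

Lemma card_roots_lt_size (F : finFieldType) (P : {poly F}) (A : {pred F}) :
  P != 0 -> {in A, forall x, root P x} -> (#|A| < size P)%N.
Proof.
move=> P_neq0 rootA; rewrite cardE; apply: max_poly_roots => //.
  by apply/allP=> x; rewrite mem_enum; apply: rootA.
exact: enum_uniq.
Qed.

Lemma size_XnBX (R : nzRingType) (m : nat) :
  (1 < m)%N -> size ('X^m - 'X : {poly R}) = m.+1.
Proof.
by move=> m_gt1; rewrite size_polyDl size_polyXn // size_polyN size_polyX.
Qed.

(** Multiplication by a nonzero x of [K] permutes the nonzero elements of [K], so their product is
    unchanged by the factor x^(#|K| - 1), which is therefore 1. *)
Lemma divring_expf_card (F : finFieldType) (K : divringClosed F) (x : F) :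
  x \in K -> x ^+ #|K| = x.
Proof.
move=> Kx; have cardK : #|K| = #|[pred y in K | y != 0]|.+1.
  rewrite (cardD1 0) rpred0 add1n; congr _.+1.
  by apply: eq_card => y; rewrite !inE andbC.
have [-> | x_neq0] := eqVneq x 0; first by rewrite cardK expr0n.
have prodK_neq0 : \prod_(y in [pred y in K | y != 0]) y != 0.
  by apply/prodf_neq0 => y /andP[].
rewrite cardK exprSr -[RHS]mul1r; congr (_ * _).
apply: (mulIf prodK_neq0); rewrite mul1r.
rewrite [RHS](reindex_inj (mulfI x_neq0)) /=.
rewrite [RHS](eq_bigl [in [pred y in K | y != 0]]); last first.
  move=> y; rewrite /= !inE mulf_eq0 negb_or x_neq0 /=; congr (_ && _).
  apply/idP/idP => [Kxy|]; last exact: rpredM.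
  by rewrite -(mulKf x_neq0 y) rpredM ?rpredV.
by rewrite big_split prodr_const.
Qed.

(** The elements of [K] already give #|K| roots of X^#|K| - X; a fixed point outside [K] would be
    one root too many. *)
Lemma mem_divring (F : finFieldType) (K : divringClosed F) (x : F) :
  (1 < #|K|)%N -> (x \in K) = (x ^+ #|K| == x).
Proof.
move=> cardK_gt1; apply/idP/eqP => [|xq]; first exact: divring_expf_card.
set P : {poly F} := 'X^#|K| - 'X.
have sizeP : size P = #|K|.+1 by apply: size_XnBX.
have P_neq0 : P != 0 by rewrite -size_poly_gt0 sizeP.
have rootP y : root P y = (y ^+ #|K| == y) by rewrite rootE !hornerE subr_eq0.
apply: contraT => notKx.
have: (#|[predU1 x & K]| < size P)%N.
  apply: card_roots_lt_size => // y /predU1P[-> | Ky]; rewrite rootP ?xq //.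
  by rewrite divring_expf_card.
by rewrite cardU1 notKx sizeP add1n ltnn.
Qed.

Lemma expr_fixed_expn (R : pzSemiRingType) (q m : nat) (x : R) :
  x ^+ q = x -> x ^+ (q ^ m) = x.
Proof.
by move=> xq; elim: m => [|m IHm]; rewrite ?expr1 // expnS exprM xq.
Qed.

Lemma dvdn_succ_ltn_mul (i k r : nat) :
  (0 < k)%N -> (i < r * k)%N -> (k %| i.+1)%N ->
  exists2 s, (0 < s <= r)%N & i = (s * k - 1)%N.
Proof.
move=> k_gt0 i_lt /dvdnP[s i_eq]; exists s; last by rewrite -i_eq subn1.
rewrite -[(s <= r)%N](leq_pmul2r k_gt0) -i_eq i_lt andbT.
by case: s i_eq.
Qed.

Lemma expr_expnD (R : pzSemiRingType) (q a b : nat) (x : R) :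
  x ^+ (q ^ (a + b)) = (x ^+ (q ^ a)) ^+ (q ^ b).
Proof. by rewrite expnD exprM. Qed.

(** * Frobenius maps and the trace form *)

Section Trace.
Context (p r k : nat) (F : finFieldType) (p_prime : prime p).
Context (k_gt0 : (0 < k)%N) (cardF : #|F| = (p ^ (r * k))%N).

Local Notation Tr := (fin_trace p (r * k) k).

Let charF : p \in [pchar F] := card_finPcharP cardF p_prime.

Lemma pnat_Frob (m : nat) : [pchar F].-nat (p ^ m)%N.
Proof. by rewrite pnatX pnatE ?charF. Qed.

Lemma exprD_Frob (m : nat) (x y : F) :
  (x + y) ^+ (p ^ m) = x ^+ (p ^ m) + y ^+ (p ^ m).
Proof. exact/exprDn_pchar/pnat_Frob. Qed.

Lemma exprN_Frob (m : nat) (x : F) : (- x) ^+ (p ^ m) = - x ^+ (p ^ m).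
Proof. exact/exprNn_pchar/pnat_Frob. Qed.

Lemma eq_oppr_id (x : F) : (2 < p)%N -> (x == - x) = (x == 0).
Proof.
move=> p_gt2; rewrite -addr_eq0 -mulr2n -mulr_natr mulf_eq0.
by rewrite -(dvdn_pcharf charF) gtnNdvd ?orbF.
Qed.

Lemma expr0_Frob (m : nat) : 0 ^+ (p ^ m) = 0 :> F.
Proof. by rewrite expr0n expn_eq0 (negPf (lt0n_neq0 (prime_gt0 p_prime))). Qed.

Lemma expr_Frob_inj (m : nat) : injective (fun x : F => x ^+ (p ^ m)).
Proof.
move=> x y /eqP; rewrite -subr_eq0 -exprN_Frob -exprD_Frob expf_eq0.
by case/andP=> _; rewrite subr_eq0 => /eqP.
Qed.

Lemma fin_traceE (x : F) : Tr x = \sum_(m < r) x ^+ (p ^ (m * k)).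
Proof. by rewrite /fin_trace mulnK. Qed.

Lemma fin_traceD (x y : F) : Tr (x + y) = Tr x + Tr y.
Proof.
by rewrite !fin_traceE -big_split; apply: eq_bigr => m _; rewrite exprD_Frob.
Qed.

Lemma fin_trace0 : Tr (0 : F) = 0.
Proof. by apply: (@addrI _ (Tr (0 : F))); rewrite -fin_traceD !addr0. Qed.

Lemma fin_trace_Frob (m : nat) (x : F) : Tr (x ^+ (p ^ m)) = Tr x ^+ (p ^ m).
Proof.
rewrite !fin_traceE (big_morph _ (exprD_Frob m) (expr0_Frob m)).
by apply: eq_bigr => a _; rewrite -!exprM mulnC.
Qed.

(** For one shift, adding y to either trace gives the same sum of r + 1 conjugates, since the last
    of them, y^(p^(rk)), is y again. *)
Lemma fin_trace_shift (m : nat) (x : F) : Tr (x ^+ (p ^ (m * k))) = Tr x.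
Proof.
have shift1 (y : F) : Tr (y ^+ (p ^ k)) = Tr y.
  rewrite !fin_traceE; apply: (@addrI _ y).
  transitivity (\sum_(m < r.+1) y ^+ (p ^ (m * k))).
    rewrite big_ord_recl mul0n expr1; congr (_ + _).
    by apply: eq_bigr => a _; rewrite -exprM -expnD.
  by rewrite big_ord_recr /= -cardF expf_card addrC.
elim: m => [|m IHm]; first by rewrite expr1.
by rewrite mulSn addnC expr_expnD shift1.
Qed.

(** If c were nonzero, the trace would vanish on all of [F], giving p^(rk) roots to a polynomial of
    degree at most p^((r-1)k). *)
Lemma fin_trace_nondegenerate (c : F) :
  (0 < r)%N -> (forall x, Tr (c * x) = 0) -> c = 0.
Proof.
move=> r_gt0 Tr0; apply: contraTeq isT => c_neq0.
pose P : {poly F} := \sum_(m < r) 'X^(p ^ (m * k)).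
have exp_inj (a : nat) : (1 == p ^ (a * k))%N = (a == 0%N).
  by rewrite -[1%N](expn0 p) eqn_exp2l ?prime_gt1 // eq_sym muln_eq0
    (gtn_eqF k_gt0) orbF.
have P_neq0 : P != 0.
  (* Only m = 0 contributes to the coefficient of X, which is therefore 1. *)
  apply/eqP=> P0; have := coef0 F 1; rewrite -P0 coef_sum.
  rewrite (bigD1 (Ordinal r_gt0)) //= coefXn big1 ?addr0 => [/eqP|a].
    by rewrite oner_eq0.
  by rewrite -val_eqE coefXn exp_inj /= => /negPf->.
have: (#|F| < size P)%N.
  apply: card_roots_lt_size => // x _.
  rewrite rootE horner_sum -{1}(mulVKf c_neq0 x) /=.
  rewrite -[X in _ == X](Tr0 (c^-1 * x)) fin_traceE; apply/eqP.
  by apply: eq_bigr => a _; rewrite hornerXn.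
rewrite ltnNge cardF; case/negP.
apply: (leq_trans (size_sum _ _ _)); apply/bigmax_leqP => a _.
by rewrite size_polyXn ltn_exp2l ?prime_gt1 // ltn_pmul2r.
Qed.

Context (K : divringClosed F) (cardK : #|K| = (p ^ k)%N).

Lemma mem_divring_Frob (x : F) : (x \in K) = (x ^+ (p ^ k) == x).
Proof.
by rewrite mem_divring cardK // (ltn_exp2l 0) // prime_gt1.
Qed.

Lemma expr_Frob_mem (m : nat) (u : F) : u \in K -> u ^+ (p ^ (m * k)) = u.
Proof.
by rewrite mem_divring_Frob mulnC expnM => /eqP; apply: expr_fixed_expn.
Qed.

Lemma fin_trace_mem (x : F) : Tr x \in K.
Proof.
rewrite mem_divring_Frob -fin_trace_Frob -[X in (p ^ X)%N]mul1n.
by rewrite fin_trace_shift.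
Qed.

Lemma fin_traceZ (u x : F) : u \in K -> Tr (u * x) = u * Tr x.
Proof.
move=> Ku; rewrite !fin_traceE mulr_sumr; apply: eq_bigr => m _.
by rewrite exprMn (expr_Frob_mem _ _ Ku).
Qed.

Lemma fin_trace_divring (u : F) : u \in K -> Tr u = u *+ r.
Proof.
move=> Ku; rewrite fin_traceE (eq_bigr (fun=> u)) => [|m _].
  by rewrite sumr_const card_ord.
exact: expr_Frob_mem.
Qed.

(** With a = m mod k, all p^k elements of [K] are fixed by the power p^a; for 0 < a < k this exceeds
    the degree of X^(p^a) - X. *)
Lemma dvdn_expr_Frob_fixed (m : nat) :
  {in K, forall u, u ^+ (p ^ m) = u} -> (k %| m)%N.
Proof.
move=> fixK; rewrite /dvdn; set a := (m %% k)%N.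
have fixKa u : u \in K -> u ^+ (p ^ a) = u.
  move=> Ku; rewrite -[RHS]fixK // (divn_eq m k) expr_expnD.
  by rewrite expr_Frob_mem.
apply: contraT; rewrite -lt0n => a_gt0.
have pa_gt1 : (1 < p ^ a)%N by rewrite (ltn_exp2l 0) // prime_gt1.
have := @card_roots_lt_size F ('X^(p ^ a) - 'X) K.
rewrite -size_poly_gt0 size_XnBX // cardK => /(_ isT).
rewrite ltnS leq_exp2l ?prime_gt1 //.
rewrite leqNgt ltn_pmod //; apply=> u Ku.
by rewrite rootE !hornerE subr_eq0 fixKa.
Qed.

(** * The quadratic trace function and its translators *)

Context (i l : nat) (beta : F) (l_le_r : (l <= r)%N).

Local Notation f := (quad_trace p (r * k) k i (i + k * l) beta).
Local Notation c gamma := (beta * gamma ^+ (p ^ (i + l * k))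
  + beta ^+ (p ^ ((r - l) * k)) * gamma ^+ (p ^ (i + (r - l) * k))).

Lemma quad_trace_translate (gamma x u : F) : u \in K ->
  f (x + u * gamma) - f x
    = u ^+ (p ^ i) * Tr (c gamma * x ^+ (p ^ i))
      + (u ^+ (p ^ i)) ^+ 2 * f gamma.
Proof.
move=> Ku; have KuP : u ^+ (p ^ i) \in K by apply: rpredX.
rewrite /quad_trace (mulnC k) !exprD !expr_expnD !exprD_Frob !exprMn.
rewrite (expr_Frob_mem _ _ KuP).
set X := x ^+ (p ^ i); set G := gamma ^+ (p ^ i); set U := u ^+ (p ^ i).
set Q := (p ^ (l * k))%N; set Q' := (p ^ ((r - l) * k))%N.
rewrite (mulrDl _ _ X) fin_traceD.
(* The trace is invariant under the power Q', and Q Q' = #|F| turns X^Q into X. *)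
have <- : Tr (beta * (X ^+ Q * G)) = Tr (beta ^+ Q' * G ^+ Q' * X).
  rewrite -(fin_trace_shift (r - l)) !exprMn -/Q' -exprM -expnD -mulnDl.
  by rewrite subnKC // -cardF expf_card mulrAC mulrA.
apply/eqP; rewrite subr_eq -fin_traceD -!fin_traceZ ?rpredX // -!fin_traceD.
by apply/eqP; congr (fin_trace _ _ _ _); ring.
Qed.

Lemma translator_coef (b gamma : F) : (0 < r)%N -> b = f gamma ->
  linear_translator K f b gamma ->
  c gamma = 0 /\ {in K, forall u, (u ^+ (p ^ i)) ^+ 2 * b = u * b}.
Proof.
move=> r_gt0 -> [_ _ _ transl]; have c0 : c gamma = 0.
  (* Take u = 1 and x the preimage of y under the power p^i: the quadratic term is then b itself and
     cancels, leaving Tr(c y) = 0. *)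
  apply: fin_trace_nondegenerate => // y.
  have [g _ Kg] := injF_bij (expr_Frob_inj i).
  have := transl (g y) 1 (rpred1 K); rewrite quad_trace_translate ?rpred1 //.
  rewrite Kg !expr1n !mul1r => /eqP.
  by rewrite -subr_eq0 addrK => /eqP.
split=> // u Ku; rewrite -(transl 0 u Ku) quad_trace_translate // c0 !mul0r.
by rewrite fin_trace0 mulr0 add0r.
Qed.

(** In characteristic 2 the two terms of [c 1] are both beta and cancel. Leaving b as r beta serves
    both parities of r. *)
Lemma one_translator (b : F) : p = 2%N -> beta \in K -> b = beta *+ r ->
  {in K, forall u, (u ^+ (p ^ i)) ^+ 2 * b = u * b} ->
  linear_translator K f b 1.
Proof.
move=> p2 Kbeta b_def ub; have char2 : 2%N \in [pchar F] by rewrite -{1}p2.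
have f1 : f 1 = b by rewrite /quad_trace expr1n mulr1 fin_trace_divring.
split=> [x|||x u Ku]; rewrite ?oner_neq0 ?b_def ?rpredMn //.
  exact: fin_trace_mem.
rewrite -b_def quad_trace_translate // !expr1n !mulr1.
rewrite (expr_Frob_mem _ _ Kbeta) addrr_pchar2 // mul0r.
by rewrite fin_trace0 mulr0 add0r f1 ub.
Qed.

Lemma translator_oddp (gamma : F) : (2 < p)%N -> beta != 0 ->
  beta \in K -> gamma != 0 -> c gamma = 0 -> f gamma = 0 ->
  [/\ ~~ odd (r * k), gamma ^+ (p ^ (2 * k * l) - 1) = -1
    & Tr (gamma ^+ (1 + p ^ (l * k))) = 0].
Proof.
move=> p_gt2 beta_neq0 Kbeta gamma_neq0 c0 f0.
(* Cancelling beta and the power p^i in [c0] leaves gamma^(q^l) = - gamma^(q^(r-l)) with q = p^k;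
   raising to the power q^l turns the right side into - gamma. *)
have tau : gamma ^+ (p ^ (2 * k * l)) = - gamma.
  move: c0; rewrite expr_Frob_mem // -mulrDr => /eqP.
  rewrite mulf_eq0 (negPf beta_neq0) /= addr_eq0 !(addnC i) !expr_expnD.
  rewrite -exprN_Frob => /eqP/expr_Frob_inj tau.
  rewrite -mulnA mul2n -addnn (mulnC k) expr_expnD tau exprN_Frob.
  by rewrite -expr_expnD -mulnDl subnK // -cardF expf_card.
split.
- apply: contraNN gamma_neq0 => odd_n.
  (* The n-th iterate of the (2kl)-th Frobenius power is the identity, but for
     n odd it negates gamma. *)
  have tau_iter m : gamma ^+ ((p ^ (2 * k * l)) ^ m) = (-1) ^+ m * gamma.
    elim: m => [|m IHm]; first by rewrite mul1r.
    rewrite expnSr exprM IHm exprMn exprAC exprN_Frob expr1n tau.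
    by rewrite exprS mulN1r mulrN mulNr.
  have := tau_iter (r * k)%N.
  rewrite -expnM mulnC expnM expr_fixed_expn -?cardF ?expf_card //.
  by rewrite -signr_odd odd_n expr1 mulN1r => /eqP; rewrite eq_oppr_id.
- rewrite -[-1](mulKf gamma_neq0) mulrN1 -tau.
  apply: (mulfI gamma_neq0).
  rewrite mulVKf // -exprS -addn1 subnK //.
  by rewrite expn_gt0 (prime_gt0 p_prime).
(* Both beta, an element of [K], and the power p^i come out of the trace. *)
have : f gamma = beta * Tr (gamma ^+ (1 + p ^ (l * k))) ^+ (p ^ i).
  rewrite /quad_trace fin_traceZ // -fin_trace_Frob; congr (_ * Tr _).
  by rewrite -exprM mulnDl mul1n -expnD (mulnC k) (addnC i).
rewrite f0 => /esym/eqP; rewrite mulf_eq0 (negPf beta_neq0) expf_eq0.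
by case/andP=> _ /eqP.
Qed.

End Trace.

Theorem theorem4 (p n r k i j l : nat) (F : finFieldType) (K : divringClosed F)
    (beta : F)
    (p_prime : prime p) (k_gt0 : (0 < k)%N) (r_gt1 : (1 < r)%N)
    (n_def : n = (r * k)%N)
    (cardF : #|F| = (p ^ n)%N) (cardK : #|K| = (p ^ k)%N)
    (beta_neq0 : beta != 0)
    (i_lt_n : (i < n)%N) (l_bounds : (0 < l < r)%N) (j_def : j = (i + k * l)%N) :
  (p = 2%N ->
    (forall gamma b : F,
       gamma != 0 ->
       b = fin_trace p n k (beta * gamma ^+ (p ^ i + p ^ (i + l * k))) ->
       linear_translator K (quad_trace p n k i j beta) b gamma ->
       beta * gamma ^+ (p ^ (i + l * k))
         + beta ^+ (p ^ ((r - l) * k)) * gamma ^+ (p ^ (i + (r - l) * k)) = 0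
       /\ ((b = fin_trace p n k (beta * gamma ^+ (2 ^ i + 2 ^ (i + l * k)))
            /\ (exists2 s : nat, (0 < s <= r)%N & i = (s * k - 1)%N))
           \/ b = 0))
    /\ (beta \in K ->
         (~~ odd r -> linear_translator K (quad_trace p n k i j beta) 0 1)
         /\ (odd r -> (exists2 s : nat, (0 < s <= r)%N & i = (s * k - 1)%N) ->
             linear_translator K (quad_trace p n k i j beta) beta 1)))
  /\
  ((2 < p)%N ->
    forall gamma b : F,
      gamma != 0 ->
      b = fin_trace p n k (beta * gamma ^+ (p ^ i + p ^ (i + l * k))) ->
      linear_translator K (quad_trace p n k i j beta) b gamma ->
      b = 0
      /\ (beta \in K ->
           [/\ ~~ odd n,
               gamma ^+ (p ^ (2 * k * l) - 1) = -1
             & fin_trace p n k (gamma ^+ (1 + p ^ (l * k))) = 0])).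
Proof.
subst n j; case/andP: l_bounds => l_gt0 l_lt_r.
have l_le_r := ltnW l_lt_r; have r_gt0 := ltnW r_gt1.
have charF := card_finPcharP cardF p_prime.
have bE gamma : fin_trace p (r * k) k
    (beta * gamma ^+ (p ^ i + p ^ (i + l * k)))
    = quad_trace p (r * k) k i (i + k * l) beta gamma.
  by rewrite (mulnC l).
split=> [p2 | p_gt2].
  split=> [gamma b gamma_neq0 b_def | Kbeta].
    rewrite bE in b_def; move=> /translator_coef[] // c0 ub.
    split=> //; have [|b_neq0] := eqVneq b 0; [by right | left].
    split; first by rewrite b_def -[2%N]p2 bE.
    (* Cancelling b leaves u^(2^(i+1)) = u on [K], hence k divides i + 1. *)
    apply: dvdn_succ_ltn_mul => //.
    apply: (dvdn_expr_Frob_fixed _ _ _ p_prime k_gt0 _ cardK) => // u Ku.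
    by apply: (mulIf b_neq0); rewrite -(ub _ Ku) p2 expnSr exprM.
  have betarE : beta *+ r = beta *+ odd r.
    have char2 : 2%N \in [pchar F] by rewrite -{1}p2.
    rewrite -{1}[r]odd_double_half mulrnDr -mul2n mulrnA (mulrn_pchar char2).
    by rewrite mul0rn addr0.
  split=> [even_r | odd_r [s /andP[s_gt0 _] i_def]].
    apply: one_translator => // [|u _]; last by rewrite !mulr0.
    by rewrite betarE (negPf even_r).
  apply: one_translator => // [|u Ku]; first by rewrite betarE odd_r.
  (* Positivity of s k makes the truncated subtraction in [i_def] exact. *)
  have i_succ : i.+1 = (s * k)%N by rewrite i_def subn1 prednK ?muln_gt0 ?s_gt0.
  rewrite -exprM (_ : p ^ i * 2 = p ^ (s * k))%N; last first.
    by rewrite -i_succ expnSr p2.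
  by rewrite (expr_Frob_mem _ _ _ p_prime k_gt0 _ cardK).
move=> gamma b gamma_neq0 b_def.
rewrite bE in b_def; move=> /translator_coef[] // c0 ub.
have b0 : b = 0.
  (* At u = -1 the square removes the sign on the left, giving b = - b. *)
  have := ub (-1); rewrite rpredN rpred1 => /(_ isT).
  rewrite -exprM mulnC exprM sqrrN !expr1n mul1r mulN1r => /eqP.
  by rewrite (eq_oppr_id _ _ _ _ p_prime cardF) // => /eqP.
split=> // Kbeta.
apply: (translator_oddp _ _ _ _ p_prime k_gt0 cardF _ cardK _ _ _ l_le_r _ _
                        beta_neq0 Kbeta _ c0) => //.
by rewrite -b_def.
Qed.
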